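(* Let $0<\sigma\le1$ and let $F(a,b)=\operatorname{sgn}(\sigma)\,|A|^{\sigma}=(a^2+b^2)^{\sigma/2}$ for $a,b>0$, where $|A|=(a^2+b^2)^{1/2}$. Then there exists no maximum-principle function (MPF) for the normal velocity $F$.
   Context: Notation: $\mathbb{R}^2_+=(0,\infty)^2$; subscripts $a,b$ denote partial derivatives. Normal velocity: a symmetric function $F\in C^2(\mathbb{R}^2_+)$, homogeneous of some degree $\sigma\in\mathbb{R}\setminus\{0\}$, with $F_a,F_b>0$ for all $a,b>0$. It is contracting if $F>0$ everywhere on $\mathbb{R}^2_+$ and expanding if $F<0$ everywhere on $\mathbb{R}^2_+$. Maximum-principle function (MPF) for a normal velocity $F$: a symmetric function $w\in C^2(\mathbb{R}^2_+)$, homogeneous of some degree $\chi\in\mathbb{R}\setminus\{0\}$, such that, with $\alpha=-w_a/w_b$ and $\alpha_a=\partial\alpha/\partial a$ (defined for $a\ne b$): (1) $w>0$ whenever $a\neq b$, and $w=0$ whenever $a=b$. (2) $\chi>0$ if $F$ is contracting, $\chi<0$ if $F$ is expanding. (3) $w_a<0$ for all $0<a<b$, and $w_a>0$ for all $0<b<a$. (4) For all $a,b>0$ (for $E_w,G_w$: $a\neq b$) one has $C_w(a,b)\le0$, $E_w(a,b)\le0$, $G_w(a,b)\le 0$, where $$C_w=w_a\,a\big((F_aa^2+F_bb^2)+(F-F_aa-F_bb)a\big)+w_b\,b\big((F_aa^2+F_bb^2)+(F-F_aa-F_bb)b\big),$$ $$E_w=w_a(F_{aa}+2F_{ab}\alpha+F_{bb}\alpha^2)-F_a(w_{aa}+2w_{ab}\alpha+w_{bb}\alpha^2)+2\,\frac{w_bF_a-w_aF_b}{a-b}\,\alpha^2,$$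 $$G_w=\frac1{\alpha^2}\Big(w_b(F_{aa}+2F_{ab}\alpha+F_{bb}\alpha^2)-F_b(w_{aa}+2w_{ab}\alpha+w_{bb}\alpha^2)+2\,\frac{w_bF_a-w_aF_b}{a-b}\Big).$$ (5) There are constants $c>0$, $d\in\mathbb{R}$ such that, evaluating $\alpha$ and $\alpha_a$ at $(a,b)=(\rho,1)$ with $0<\rho<1$: if $F$ is contracting, then either $\alpha=c$ and $\alpha_a=0$ for all sufficiently small $\rho$, or, as $\rho\to0$, $\alpha=\frac c\rho+o(\rho^{-1})$ and $\alpha_a=-\frac c{\rho^2}+o(\rho^{-1})$; if $F$ is expanding, then, as $\rho\to0$, either $\alpha=\frac c\rho+o(\rho^{-1})$ and $\alpha_a=-\frac c{\rho^2}+o(\rho^{-1})$, or $\alpha=\frac{c+d\rho}{\rho^2}+o(\rho^{-1})$ and $\alpha_a=-\frac{2c+d\rho}{\rho^3}+o(\rho^{-1})$. *)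

(* Defs.v *)
From Stdlib Require Import Reals Lra.
From Coquelicot Require Import Coquelicot.
Open Scope R_scope.

(* Functions on the open quadrant (0,oo)^2 are represented by total functions
   R -> R -> R of which only the values at positive arguments are constrained.
   Since the quadrant is open, partial derivatives there depend on these values
   only. *)

Definition d_a (f : R -> R -> R) : R -> R -> R := partial_derive 1 0 f.
Definition d_b (f : R -> R -> R) : R -> R -> R := partial_derive 0 1 f.
Definition d_aa (f : R -> R -> R) : R -> R -> R := partial_derive 2 0 f.
Definition d_ab (f : R -> R -> R) : R -> R -> R := partial_derive 1 1 f.
Definition d_bb (f : R -> R -> R) : R -> R -> R := partial_derive 0 2 f.

Definition symmetric_on_quadrant (f : R -> R -> R) : Prop :=
  forall a b, 0 < a -> 0 < b -> f a b = f b a.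

(* [ex_diff_n f 2 a b] asserts that all partial derivatives of order at most 2
   exist and are continuous at (a,b). *)
Definition C2_on_quadrant (f : R -> R -> R) : Prop :=
  forall a b, 0 < a -> 0 < b -> ex_diff_n f 2 a b.

Definition homogeneous_on_quadrant (s : R) (f : R -> R -> R) : Prop :=
  forall t a b, 0 < t -> 0 < a -> 0 < b ->
    f (t * a) (t * b) = Rpower t s * f a b.

Record normal_velocity (F : R -> R -> R) : Prop := {
  nv_symmetric : symmetric_on_quadrant F;
  nv_C2 : C2_on_quadrant F;
  nv_homogeneous : exists sigma, sigma <> 0 /\ homogeneous_on_quadrant sigma F;
  nv_monotone : forall a b, 0 < a -> 0 < b -> 0 < d_a F a b /\ 0 < d_b F a b
}.

Definition contracting (F : R -> R -> R) : Prop :=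
  forall a b, 0 < a -> 0 < b -> 0 < F a b.

Definition expanding (F : R -> R -> R) : Prop :=
  forall a b, 0 < a -> 0 < b -> F a b < 0.

Definition alpha (w : R -> R -> R) (a b : R) : R := - d_a w a b / d_b w a b.

Definition C_w (F w : R -> R -> R) (a b : R) : R :=
  d_a w a b * a *
    ((d_a F a b * a ^ 2 + d_b F a b * b ^ 2)
     + (F a b - d_a F a b * a - d_b F a b * b) * a)
  + d_b w a b * b *
    ((d_a F a b * a ^ 2 + d_b F a b * b ^ 2)
     + (F a b - d_a F a b * a - d_b F a b * b) * b).

Definition E_w (F w : R -> R -> R) (a b : R) : R :=
  d_a w a b *
    (d_aa F a b + 2 * d_ab F a b * alpha w a b + d_bb F a b * alpha w a b ^ 2)
  - d_a F a b *
    (d_aa w a b + 2 * d_ab w a b * alpha w a b + d_bb w a b * alpha w a b ^ 2)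
  + 2 * ((d_b w a b * d_a F a b - d_a w a b * d_b F a b) / (a - b))
    * alpha w a b ^ 2.

Definition G_w (F w : R -> R -> R) (a b : R) : R :=
  1 / alpha w a b ^ 2 *
  (d_b w a b *
    (d_aa F a b + 2 * d_ab F a b * alpha w a b + d_bb F a b * alpha w a b ^ 2)
  - d_b F a b *
    (d_aa w a b + 2 * d_ab w a b * alpha w a b + d_bb w a b * alpha w a b ^ 2)
  + 2 * ((d_b w a b * d_a F a b - d_a w a b * d_b F a b) / (a - b))).

(* f(rho) = g(rho) + o(1/rho) as rho -> 0, rho > 0 *)
Definition eq_up_to_o_inv (f g : R -> R) : Prop :=
  is_domin (at_right 0) (fun rho : R => / rho) (fun rho : R => f rho - g rho).

Definition alpha_eventually_const (w : R -> R -> R) (c : R) : Prop :=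
  at_right 0 (fun rho => alpha w rho 1 = c /\ d_a (alpha w) rho 1 = 0).

Definition alpha_order_one (w : R -> R -> R) (c : R) : Prop :=
  eq_up_to_o_inv (fun rho => alpha w rho 1) (fun rho => c / rho) /\
  eq_up_to_o_inv (fun rho => d_a (alpha w) rho 1) (fun rho => - (c / rho ^ 2)).

Definition alpha_order_two (w : R -> R -> R) (c d : R) : Prop :=
  eq_up_to_o_inv (fun rho => alpha w rho 1)
    (fun rho => (c + d * rho) / rho ^ 2) /\
  eq_up_to_o_inv (fun rho => d_a (alpha w) rho 1)
    (fun rho => - ((2 * c + d * rho) / rho ^ 3)).

Record MPF (F w : R -> R -> R) : Prop := {
  mpf_symmetric : symmetric_on_quadrant w;
  mpf_C2 : C2_on_quadrant w;
  mpf_pos : forall a b, 0 < a -> 0 < b -> a <> b -> 0 < w a b;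
  mpf_diag : forall a, 0 < a -> w a a = 0;
  mpf_homogeneous : exists chi, chi <> 0 /\ homogeneous_on_quadrant chi w /\
    (contracting F -> 0 < chi) /\ (expanding F -> chi < 0);
  mpf_decreasing : forall a b, 0 < a -> a < b -> d_a w a b < 0;
  mpf_increasing : forall a b, 0 < b -> b < a -> 0 < d_a w a b;
  mpf_C : forall a b, 0 < a -> 0 < b -> C_w F w a b <= 0;
  mpf_E : forall a b, 0 < a -> 0 < b -> a <> b -> E_w F w a b <= 0;
  mpf_G : forall a b, 0 < a -> 0 < b -> a <> b -> G_w F w a b <= 0;
  mpf_asymptotics : exists c d, 0 < c /\
    (contracting F -> alpha_eventually_const w c \/ alpha_order_one w c) /\
    (expanding F -> alpha_order_one w c \/ alpha_order_two w c d)
}.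

Definition normA (a b : R) : R := sqrt (a ^ 2 + b ^ 2).

Definition F_powA (sigma : R) (a b : R) : R :=
  sign sigma * Rpower (normA a b) sigma.

Lemma sq_pos a b : 0 < a -> 0 < a ^ 2 + b ^ 2.
Proof. intros; nra. Qed.

Lemma powA_eq sigma a b : 0 < a ->
  Rpower (normA a b) sigma = exp (sigma / 2 * ln (a ^ 2 + b ^ 2)).
Proof.
  intros Ha. unfold normA.
  rewrite <- (Rpower_sqrt (a ^ 2 + b ^ 2)) by now apply sq_pos.
  rewrite Rpower_mult. unfold Rpower. f_equal. field.
Qed.

Lemma locally_2d_quadrant (P : R -> R -> Prop) a b : 0 < a -> 0 < b ->
  (forall u v, 0 < u -> 0 < v -> P u v) -> locally_2d P a b.
Proof.
  intros Ha Hb H. exists (mkposreal _ (Rmin_pos _ _ Ha Hb)).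
  simpl; intros u v Hu Hv.
  pose proof (Rmin_l a b); pose proof (Rmin_r a b).
  apply Rabs_def2 in Hu; apply Rabs_def2 in Hv. apply H; lra.
Qed.

Definition Cn_on_quadrant (n : nat) (f : R -> R -> R) : Prop :=
  forall a b, 0 < a -> 0 < b -> ex_diff_n f n a b.

Lemma Cn_ext n f g : (forall a b, 0 < a -> 0 < b -> f a b = g a b) ->
  Cn_on_quadrant n f -> Cn_on_quadrant n g.
Proof.
  intros H Hf a b Ha Hb. apply ex_diff_n_ext_loc with f; [|now apply Hf].
  now apply locally_2d_quadrant.
Qed.

Lemma Cn_plus n : forall f g, Cn_on_quadrant n f -> Cn_on_quadrant n g ->
  Cn_on_quadrant n (fun u v => f u v + g u v).
Proof.
  induction n as [|n IH]; intros f g Hf Hg a b Ha Hb.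
  - destruct (Hf a b Ha Hb), (Hg a b Ha Hb).
    split; [now apply continuity_2d_pt_plus|trivial].
  - destruct (Hf a b Ha Hb) as [cf [fa [fb _]]], (Hg a b Ha Hb) as [cg [ga [gb _]]].
    split; [now apply continuity_2d_pt_plus|].
    split; [now apply (ex_derive_plus (V := R_NormedModule))|].
    split; [now apply (ex_derive_plus (V := R_NormedModule))|].
    clear cf fa fb cg ga gb. split; revert a b Ha Hb.
    + apply Cn_ext with (fun u v =>
        Derive (fun z => f z v) u + Derive (fun z => g z v) u).
      * intros a b Ha Hb. symmetry. apply Derive_plus;
          [apply (Hf a b Ha Hb)|apply (Hg a b Ha Hb)].
      * apply IH; intros a b Ha Hb; [apply (Hf a b Ha Hb)|apply (Hg a b Ha Hb)].
    + apply Cn_ext with (fun u v =>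
        Derive (fun z => f u z) v + Derive (fun z => g u z) v).
      * intros a b Ha Hb. symmetry. apply Derive_plus;
          [apply (Hf a b Ha Hb)|apply (Hg a b Ha Hb)].
      * apply IH; intros a b Ha Hb; [apply (Hf a b Ha Hb)|apply (Hg a b Ha Hb)].
Qed.

Definition mono (c k : R) (i j : nat) (u v : R) : R :=
  c * u ^ i * v ^ j * exp (k * ln (u ^ 2 + v ^ 2)).

Lemma exp_shift k x : 0 < x -> exp (k * ln x) = x * exp ((k - 1) * ln x).
Proof.
  intros Hx. replace (k * ln x) with (ln x + (k - 1) * ln x) by ring.
  now rewrite exp_plus, exp_ln.
Qed.

Lemma is_derive_mono_a c k i j u v : 0 < u ->
  is_derive (fun z => mono c k i j z v) u
    (mono (c * INR i) k (pred i) j u v + mono (2 * c * k) (k - 1) (S i) j u v).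
Proof.
  intros Hu. pose proof (sq_pos u v Hu). unfold mono. auto_derive.
  - nra.
  - rewrite !(exp_shift k) by (simpl in *; lra). simpl in *. field. nra.
Qed.

Lemma is_derive_mono_b c k i j u v : 0 < u ->
  is_derive (fun z => mono c k i j u z) v
    (mono (c * INR j) k i (pred j) u v + mono (2 * c * k) (k - 1) i (S j) u v).
Proof.
  intros Hu. pose proof (sq_pos u v Hu). unfold mono. auto_derive.
  - nra.
  - rewrite !(exp_shift k) by (simpl in *; lra). simpl in *. field. nra.
Qed.

Lemma continuity_2d_pow_a i a b : continuity_2d_pt (fun u _ => u ^ i) a b.
Proof.
  induction i; simpl; [apply continuity_2d_pt_const|].
  apply continuity_2d_pt_mult; [apply continuity_2d_pt_id1|assumption].
Qed.

Lemma continuity_2d_pow_b i a b : continuity_2d_pt (fun _ v => v ^ i) a b.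
Proof.
  induction i; simpl; [apply continuity_2d_pt_const|].
  apply continuity_2d_pt_mult; [apply continuity_2d_pt_id2|assumption].
Qed.

Lemma continuity_2d_mono c k i j a b : 0 < a ->
  continuity_2d_pt (mono c k i j) a b.
Proof.
  intros Ha. unfold mono.
  repeat apply continuity_2d_pt_mult; [apply continuity_2d_pt_const
    |apply continuity_2d_pow_a|apply continuity_2d_pow_b|].
  apply (continuity_1d_2d_pt_comp (fun z => exp (k * ln z))
           (fun u v => u ^ 2 + v ^ 2)).
  - apply derivable_continuous_pt, ex_derive_Reals_0. auto_derive.
    now apply sq_pos.
  - apply continuity_2d_pt_plus;
      [apply continuity_2d_pow_a|apply continuity_2d_pow_b].
Qed.

Lemma Cn_mono n : forall c k i j, Cn_on_quadrant n (mono c k i j).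
Proof.
  induction n as [|n IH]; intros c k i j a b Ha Hb.
  - split; [now apply continuity_2d_mono|trivial].
  - split; [now apply continuity_2d_mono|].
    split; [eexists; now apply is_derive_mono_a|].
    split; [eexists; now apply is_derive_mono_b|].
    split; revert a b Ha Hb; (eapply Cn_ext; [|apply Cn_plus; apply IH]);
      intros a b Ha Hb; symmetry; apply is_derive_unique;
      [now apply is_derive_mono_a|now apply is_derive_mono_b].
Qed.

Lemma F_powA_mono sigma a b : 0 < a ->
  F_powA sigma a b = mono (sign sigma) (sigma / 2) 0 0 a b.
Proof. intros Ha. unfold F_powA, mono. rewrite powA_eq by trivial. ring. Qed.

Lemma sign_mul_pos s : s <> 0 -> 0 < sign s * s.
Proof.
  intros Hs. destruct (Rtotal_order s 0) as [H|[H|H]]; [|easy|].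
  - rewrite sign_eq_m1 by trivial; lra.
  - rewrite sign_eq_1 by trivial; lra.
Qed.

Lemma F_powA_normal_velocity sigma : sigma <> 0 -> normal_velocity (F_powA sigma).
Proof.
  intros Hs. split.
  - intros a b Ha Hb. unfold F_powA, normA. now rewrite Rplus_comm.
  - change (Cn_on_quadrant 2 (F_powA sigma)).
    eapply Cn_ext; [|apply Cn_mono].
    intros; symmetry; now apply F_powA_mono.
  - exists sigma; split; [trivial|]. intros t a b Ht Ha Hb. unfold F_powA, normA.
    replace ((t * a) ^ 2 + (t * b) ^ 2) with (t ^ 2 * (a ^ 2 + b ^ 2)) by ring.
    rewrite sqrt_mult, sqrt_pow2 by nra.
    rewrite <- Rpower_mult_distr by (try apply sqrt_lt_R0; nra). ring.
  - intros a b Ha Hb. pose proof (sign_mul_pos sigma Hs) as Hp.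
    pose proof (exp_pos ((sigma / 2 - 1) * ln (a ^ 2 + b ^ 2))) as He.
    split; unfold d_a, d_b, partial_derive; simpl.
    + rewrite (Derive_ext_loc _ (fun z => mono (sign sigma) (sigma / 2) 0 0 z b)).
      * rewrite (is_derive_unique _ _ _ (is_derive_mono_a _ _ _ _ _ _ Ha)).
        unfold mono. simpl INR. simpl pow in *.
        replace (_ + _) with (sign sigma * sigma * a *
          exp ((sigma / 2 - 1) * ln (a * (a * 1) + b * (b * 1)))) by field.
        apply Rmult_lt_0_compat; [nra|trivial].
      * exists (mkposreal a Ha). intros z Hz. apply F_powA_mono.
        apply Rabs_def2 in Hz; simpl in Hz; unfold minus, plus, opp in Hz; simpl in Hz.
        lra.
    + rewrite (Derive_ext _ (fun z => mono (sign sigma) (sigma / 2) 0 0 a z)).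
      * rewrite (is_derive_unique _ _ _ (is_derive_mono_b _ _ _ _ _ _ Ha)).
        unfold mono. simpl INR. simpl pow in *.
        replace (_ + _) with (sign sigma * sigma * b *
          exp ((sigma / 2 - 1) * ln (a * (a * 1) + b * (b * 1)))) by field.
        apply Rmult_lt_0_compat; [nra|trivial].
      * intros z. now apply F_powA_mono.
Qed.

(* Main.v *)
(* Write [C_w = P (a w_a + b w_b) + Q (a^2 w_a + b^2 w_b)] with
   [P = F_a a^2 + F_b b^2 > 0] and [Q = F - a F_a - b F_b]. Euler's identity gives
   [Q = (1 - sigma) F >= 0] and, since [F] is contracting,
   [a w_a + b w_b = chi w > 0] for [a <> b]. At [a < b] symmetry gives [w_b > 0], so
   [a^2 w_a + b^2 w_b = a (a w_a + b w_b) + (b - a) b w_b] is positive as well.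
   Hence [C_w > 0], against condition (4); condition (5) plays no role. *)
Require Import Defs.
From Stdlib Require Import Reals Lra.
From Coquelicot Require Import Coquelicot.
Open Scope R_scope.

(** Total differentiability, for the chain rule: it is enough that [d_a f] exists nearby and is
    continuous at the point while [d_b f] exists there. *)
Lemma C2_differentiable_pt_lim f a b : C2_on_quadrant f -> 0 < a -> 0 < b ->
  differentiable_pt_lim f a b (d_a f a b) (d_b f a b).
Proof.
  intros Hf Ha Hb. apply filterdiff_differentiable_pt_lim.
  apply (is_derive_filterdiff f a b (d_a f) (d_b f a b)).
  - apply (locally_2d_locally
      (fun u v => is_derive (fun z => f z v) u (d_a f u v))).
    apply locally_2d_quadrant; trivial. intros u v Hu Hv.
    apply Derive_correct, (Hf u v Hu Hv).
  - apply Derive_correct, (Hf a b Ha Hb).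
  - destruct (Hf a b Ha Hb) as (_ & _ & _ & H & _).
    apply (continuity_2d_pt_filterlim (d_a f)), H.
Qed.

(** Differentiate [f (t * a) (t * b)] at [t = 1] twice: by the chain rule ([H1]) and through
    homogeneity ([H2]). *)
Lemma euler_identity s f a b : C2_on_quadrant f -> homogeneous_on_quadrant s f ->
  0 < a -> 0 < b -> a * d_a f a b + b * d_b f a b = s * f a b.
Proof.
  intros Hf Hh Ha Hb.
  assert (H1 : derivable_pt_lim (fun t => f (t * a) (t * b)) 1
                 (d_a f a b * a + d_b f a b * b)).
  { apply derivable_pt_lim_comp_2d.
    - rewrite !Rmult_1_l. now apply C2_differentiable_pt_lim.
    - apply is_derive_Reals. auto_derive; [trivial|ring].
    - apply is_derive_Reals. auto_derive; [trivial|ring]. }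
  assert (H2 : is_derive (fun t => f (t * a) (t * b)) 1 (s * f a b)).
  { apply is_derive_ext_loc with (fun t => Rpower t s * f a b).
    (* Radius 1 around [t = 1] keeps [t] positive, where homogeneity applies. *)
    - exists (mkposreal 1 Rlt_0_1). intros t Ht. symmetry. apply Hh; trivial.
      apply Rabs_def2 in Ht; simpl in Ht; unfold minus, plus, opp in Ht;
        simpl in Ht. lra.
    - unfold Rpower. auto_derive; [lra|].
      rewrite ln_1, Rmult_0_r, exp_0. field. }
  apply is_derive_Reals, is_derive_unique in H1.
  rewrite (Rmult_comm a), (Rmult_comm b), <- H1. now apply is_derive_unique.
Qed.

Lemma symmetric_d_b f a b : symmetric_on_quadrant f -> 0 < a -> 0 < b ->
  d_b f a b = d_a f b a.
Proof.
  intros Hf Ha Hb. unfold d_a, d_b, partial_derive; simpl.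
  apply Derive_ext_loc. exists (mkposreal b Hb). intros z Hz. apply Hf; trivial.
  apply Rabs_def2 in Hz; simpl in Hz; unfold minus, plus, opp in Hz; simpl in Hz.
  lra.
Qed.

Lemma contracting_degree_le_1_no_MPF sigma F w :
  normal_velocity F -> contracting F -> homogeneous_on_quadrant sigma F ->
  sigma <= 1 -> ~ MPF F w.
Proof.
  intros HF Hpos Hhom Hs Hw.
  destruct (mpf_homogeneous _ _ Hw) as (chi & _ & Hwh & Hchi & _).
  specialize (Hchi Hpos).
  (* Any point with [0 < a < b] would do; [(1, 2)] keeps the arithmetic numeric. *)
  assert (H1 : 0 < 1) by lra. assert (H2 : 0 < 2) by lra.
  pose proof (euler_identity _ _ 1 2 (mpf_C2 _ _ Hw) Hwh H1 H2) as Ew.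
  pose proof (euler_identity _ _ 1 2 (nv_C2 _ HF) Hhom H1 H2) as EF.
  assert (Hwp : 0 < chi * w 1 2)
    by (apply Rmult_lt_0_compat; [|apply (mpf_pos _ _ Hw)]; lra).
  assert (Hwb : 0 < d_b w 1 2).
  { rewrite symmetric_d_b by (trivial; apply (mpf_symmetric _ _ Hw)).
    apply (mpf_increasing _ _ Hw); lra. }
  assert (HQ : 0 <= (1 - sigma) * F 1 2)
    by (apply Rmult_le_pos; [|apply Rlt_le, Hpos]; lra).
  destruct (nv_monotone _ HF 1 2 H1 H2) as [Fa Fb].
  pose proof (mpf_C _ _ Hw 1 2 H1 H2) as HC. unfold C_w in HC.
  (* Here [C_w] equals [(F_a + 4 F_b) chi w + (1 - sigma) F (chi w + 2 w_b)], with first term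
     positive and second nonnegative. *)
  nra.
Qed.

Lemma F_powA_contracting sigma : 0 < sigma -> contracting (F_powA sigma).
Proof.
  intros Hs a b _ _. unfold F_powA, Rpower. rewrite sign_eq_1, Rmult_1_l by trivial.
  apply exp_pos.
Qed.

Lemma F_powA_homogeneous sigma : homogeneous_on_quadrant sigma (F_powA sigma).
Proof.
  intros t a b Ht Ha Hb. unfold F_powA, normA.
  replace ((t * a) ^ 2 + (t * b) ^ 2) with (t ^ 2 * (a ^ 2 + b ^ 2)) by ring.
  rewrite sqrt_mult, sqrt_pow2 by nra.
  rewrite <- Rpower_mult_distr by (try apply sqrt_lt_R0; nra). ring.
Qed.

Theorem theorem9p2 : forall sigma : R, 0 < sigma <= 1 ->
  ~ exists w : R -> R -> R, MPF (F_powA sigma) w.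
Proof.
  intros sigma [H0 H1] [w Hw].
  apply (contracting_degree_le_1_no_MPF sigma (F_powA sigma) w); trivial.
  - apply F_powA_normal_velocity; lra.
  - now apply F_powA_contracting.
  - apply F_powA_homogeneous.
Qed.
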